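(* The vanishing viscosity germ $\mathcal G_{VV}$ coincides with the set of all $\vec u=(u_1,\dots,u_{m+n})\in[0,R]^{m+n}$ for which there exists $p\in[0,R]$ such that $$\sum_{i=1}^{m}G_i(u_i,p)=\sum_{j=m+1}^{m+n}G_j(p,u_j),$$ $$\forall s\in I[u_i,p]\quad(p-u_i)(f_i(s)-f_i(u_i))\ge0,\quad\text{for } i=1,\dots,m,$$ $$\forall s\in I[p,u_j]\quad(u_j-p)(f_j(s)-f_j(u_j))\ge0,\quad\text{for } j=m+1,\dots,m+n.$$
   Context: $m,n\ge1$ are integers, $R>0$; indices $i\in\{1,\dots,m\}$, $j\in\{m+1,\dots,m+n\}$, $h\in\{1,\dots,m+n\}$. For each $h$, the flux $f_h:[0,R]\to[0,+\infty)$ satisfies: (F) $f_h$ is Lipschitz with $\|f_h'\|_\infty\le L_h$, $f_h(0)=f_h(R)=0$, and there exists $\bar\rho_h\in(0,R)$ such that $f_h'(\rho)(\bar\rho_h-\rho)>0$ for a.e. $\rho\in[0,R]$; (NLD) $f_h'$ is not constant on any non-trivial subinterval of $[0,R]$. Godunov flux: $G_h(a,b)=\min_{s\in[a,b]}f_h(s)$ if $a\le b$ and $G_h(a,b)=\max_{s\in[b,a]}f_h(s)$ if $a\ge b$, for $a,b\in[0,R]$. Notation: $I[a,b]=[\min\{a,b\},\max\{a,b\}]$. Vanishing viscosity germ: $\mathcal G_{VV}$ is the set of $\vec u=(u_1,\dots,u_{m+n})\in[0,R]^{m+n}$ for which there exists $p\in[0,R]$ such that $\sum_{i=1}^mG_i(u_i,p)=\sum_{j=m+1}^{m+n}G_j(p,u_j)$,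 $G_i(u_i,p)=f_i(u_i)$ for all $i$, and $G_j(p,u_j)=f_j(u_j)$ for all $j$. *)

(* Defs.v *)
From HB Require Import structures.
From mathcomp Require Export all_boot all_order all_algebra.
From mathcomp Require Export all_classical all_reals all_analysis.

Set Implicit Arguments.
Unset Strict Implicit.
Unset Printing Implicit Defensive.

Import Order.TTheory GRing.Theory Num.Theory.
Import numFieldNormedType.Exports.

Local Open Scope classical_set_scope.
Local Open Scope ring_scope.

(* A flux is a total function R -> R of which only the restriction to
   [0, rmax] is constrained or used.  Its two-sided derivative at interior
   points depends on that restriction only, and the endpoints are negligible
   for Lebesgue measure. *)

Record flux_F {R : realType} (rmax L : R) (f : R -> R) : Prop := FluxF {
  flux_ge0 : forall x : R, x \in `[0, rmax] -> 0 <= f x ;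
  flux_lipschitz : [lipschitz f x | x in [set` `[0, rmax]]] ;
  flux_deriv_bound :
    ('N[@lebesgue_measure R]_+oo[
        (fun x : R => (derive1 f x)%:E) \_ [set` `[0%R, rmax]]] <= L%:E)%E ;
  flux_at0 : f 0 = 0 ;
  flux_atmax : f rmax = 0 ;
  flux_bell : exists2 rbar : R, 0 < rbar < rmax &
    {ae @lebesgue_measure R, forall x : R, x \in `[0, rmax] ->
       derivable f x 1 /\ 0 < derive1 f x * (rbar - x)} }.

(* The derivative exists only almost everywhere, so "constant" means
   almost everywhere equal to a constant. *)
Definition flux_NLD {R : realType} (rmax : R) (f : R -> R) : Prop :=
  forall a b : R, 0 <= a -> a < b -> b <= rmax ->
    ~ exists c : R, {ae @lebesgue_measure R, forall x : R, x \in `[a, b] ->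
                       derivable f x 1 /\ derive1 f x = c}.

(* Least and greatest element of a set of reals, with junk value 0 when there
   is none; [set_minE] and [set_maxE] identify them when they exist. *)
Definition set_min {R : realType} (A : set R) : R :=
  xget 0 [set y | A y /\ lbound A y].

Definition set_max {R : realType} (A : set R) : R :=
  xget 0 [set y | A y /\ ubound A y].

Lemma set_minE {R : realType} (A : set R) (y : R) :
  A y -> lbound A y -> set_min A = y.
Proof.
move=> Ay lAy; apply: xget_unique => // z [Az lAz].
by apply/le_anti; rewrite lAz // lAy.
Qed.

Lemma set_maxE {R : realType} (A : set R) (y : R) :
  A y -> ubound A y -> set_max A = y.
Proof.
move=> Ay uAy; apply: xget_unique => // z [Az uAz].
by apply/le_anti; rewrite uAz // uAy.
Qed.

Definition godunov {R : realType} (f : R -> R) (a b : R) : R :=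
  if a <= b then set_min (f @` [set` `[a, b]])
  else set_max (f @` [set` `[b, a]]).

(* Unordered interval I[a, b] *)
Definition segm {R : realType} (a b : R) : interval R :=
  `[Num.min a b, Num.max a b].

(* The roads are indexed by 'I_(m + n): [lshift n i], i : 'I_m, are the
   incoming ones and [rshift m j], j : 'I_n, the outgoing ones. *)

Definition germ_VV {R : realType} (m n : nat) (rmax : R)
    (f : 'I_(m + n) -> R -> R) : set 'rV[R]_(m + n) :=
  [set u | (forall h, u ord0 h \in `[0, rmax]) /\
    exists2 p : R, p \in `[0, rmax] &
      [/\ \sum_(i < m) godunov (f (lshift n i)) (u ord0 (lshift n i)) p =
          \sum_(j < n) godunov (f (rshift m j)) p (u ord0 (rshift m j)),
          forall i : 'I_m, godunov (f (lshift n i)) (u ord0 (lshift n i)) p =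
                           f (lshift n i) (u ord0 (lshift n i)) &
          forall j : 'I_n, godunov (f (rshift m j)) p (u ord0 (rshift m j)) =
                           f (rshift m j) (u ord0 (rshift m j))]].

(* Main.v *)
Require Import Defs.
Import Order.TTheory GRing.Theory Num.Theory.
Import numFieldNormedType.Exports.

Local Open Scope classical_set_scope.
Local Open Scope ring_scope.

(** The two descriptions share the state [p] and the balance of fluxes, so they
    agree as soon as, road by road, the Godunov condition [G(a, b) = f(c)] at an
    endpoint [c] of the segment says the same as a sign condition on that
    segment.  It does: for [a < b], [G(a, b)] is the minimum of [f] on [[a, b]],
    and it equals [f(c)] exactly when [f(s) - f(c) >= 0] on the whole segment;
    for [a > b] it is the maximum, and all these differences are [<= 0].  The
    factor [b - a] supplies the sign that merges both cases, and the case
    [a = b] is trivial.  This is [godunov_eqP].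

    The implication from the value of [G] to the sign condition needs the
    minimum and the maximum to be attained.  The Lipschitz hypothesis gives
    continuity, and the extreme value theorem does the rest. *)

(** Attainment, the last hypothesis, rules out the junk value of [set_min],
    which [f c] could otherwise equal by accident. *)
Lemma set_min_image_eqP {T : Type} {R : realType} (f : T -> R) (A : set T)
    (c : T) : A c -> (exists2 d, A d & forall s, A s -> f d <= f s) ->
  set_min (f @` A) = f c <-> forall s, A s -> f c <= f s.
Proof.
move=> Ac [d Ad fd]; split=> [<- s As|fc].
  rewrite (@set_minE _ _ (f d)); first exact: fd; first by exists d.
  by move=> _ [x Ax <-]; exact: fd.
by apply: set_minE; [exists c | move=> _ [x Ax <-]; exact: fc].
Qed.

Lemma set_max_image_eqP {T : Type} {R : realType} (f : T -> R) (A : set T)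
    (c : T) : A c -> (exists2 d, A d & forall s, A s -> f s <= f d) ->
  set_max (f @` A) = f c <-> forall s, A s -> f s <= f c.
Proof.
move=> Ac [d Ad fd]; split=> [<- s As|fc].
  rewrite (@set_maxE _ _ (f d)); first exact: fd; first by exists d.
  by move=> _ [x Ax <-]; exact: fd.
by apply: set_maxE; [exists c | move=> _ [x Ax <-]; exact: fc].
Qed.

(** Letting [c] be any point of the segment covers both uses of the Godunov
    flux at a junction: [c = a] on incoming roads, [c = b] on outgoing ones. *)
Lemma godunov_eqP {R : realType} (f : R -> R) (a b c : R) :
  {within [set` segm a b], continuous f} -> c \in segm a b ->
  godunov f a b = f c <->
  forall s, s \in segm a b -> 0 <= (b - a) * (f s - f c).
Proof.
rewrite /godunov /segm; case: (ltgtP a b) => [ab|ba|<-] cf c_ab.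
- have [min_f f_min] :=
    @set_min_image_eqP _ _ f [set` _] c c_ab (EVT_min (ltW ab) cf).
  split=> [/min_f fc s s_ab|fc].
    by rewrite pmulr_rge0 ?subr_gt0 // subr_ge0; exact: fc.
  by apply: f_min => s /fc; rewrite pmulr_rge0 ?subr_gt0 // subr_ge0.
- have [max_f f_max] :=
    @set_max_image_eqP _ _ f [set` _] c c_ab (EVT_max (ltW ba) cf).
  split=> [/max_f fc s s_ab|fc].
    by rewrite nmulr_rge0 ?subr_lt0 // subr_le0; exact: fc.
  by apply: f_max => s /fc; rewrite nmulr_rge0 ?subr_lt0 // subr_le0.
- move: c_ab; rewrite in_itv /= -eq_le => /eqP <-.
  split=> [_ s _|_]; first by rewrite subrr mul0r.
  apply: set_minE; first by exists a => //=; rewrite in_itv /= lexx.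
  by move=> _ [s /=] + <-; rewrite in_itv /= -eq_le => /eqP <-.
Qed.

Lemma lipschitz_within_continuous {R : realType} {V W : normedModType R}
    (A : set V) (f : V -> W) :
  [lipschitz f x | x in A] -> {within A, continuous f}.
Proof.
move=> lf; near (pinfty_nbhs R) => k.
have k_gt0 : 0 < k by near: k; exact: nbhs_pinfty_gt.
have kf : k.-lipschitz_A f by near: k; exact: lf.
apply/subspace_continuousP => x Ax; apply/cvgrPdist_lt => e e_gt0.
have /cvgrPdist_lt/(_ (e / k)) xk : id @ within A (nbhs x) --> x.
  exact: cvg_within.
near=> y.
have Ay : A y by near: y; exact: withinT.
apply: le_lt_trans (kf (x, y) (conj Ax Ay)) _ => /=.
by rewrite -ltr_pdivlMl // mulrC; near: y; apply: xk; rewrite divr_gt0.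
Unshelve. all: by end_near. Qed.

Lemma segm_sub_itvcc {R : realType} (x y a b : R) :
  a \in `[x, y] -> b \in `[x, y] -> [set` segm a b] `<=` [set` `[x, y]].
Proof.
rewrite !in_itv /= => /andP[xa ay] /andP[xb yb] s /=.
rewrite !in_itv /= ge_min le_max => /andP[/orP[|] le1 /orP[|] le2];
  by rewrite ?(le_trans _ le1) ?(le_trans le2).
Qed.

(** The Lipschitz bound on [[0, rmax]] supplies the continuity on the segment
    that the extreme value theorem asks for. *)
Lemma flux_godunov_eqP {R : realType} (rmax L : R) (f : R -> R) (a b c : R) :
  flux_F rmax L f -> a \in `[0, rmax] -> b \in `[0, rmax] -> c \in segm a b ->
  godunov f a b = f c <->
  forall s, s \in segm a b -> 0 <= (b - a) * (f s - f c).
Proof.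
move=> fF a_r b_r c_ab; apply: godunov_eqP => //.
apply: (continuous_subspaceW (segm_sub_itvcc _ _ _ _ a_r b_r)).
exact: lipschitz_within_continuous _ _ (flux_lipschitz fF).
Qed.

Theorem lemma2p2 (R : realType) (m n : nat) (rmax : R)
    (L : 'I_(m + n) -> R) (f : 'I_(m + n) -> R -> R)
    (m_ge1 : (1 <= m)%N) (n_ge1 : (1 <= n)%N) (rmax_gt0 : 0 < rmax)
    (fF : forall h, flux_F rmax (L h) (f h))
    (fNLD : forall h, flux_NLD rmax (f h)) :
  germ_VV rmax f =
  [set u : 'rV[R]_(m + n) | (forall h, u ord0 h \in `[0, rmax]) /\
    exists2 p : R, p \in `[0, rmax] &
      [/\ \sum_(i < m) godunov (f (lshift n i)) (u ord0 (lshift n i)) p =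
          \sum_(j < n) godunov (f (rshift m j)) p (u ord0 (rshift m j)),
          forall i : 'I_m, forall s : R, s \in segm (u ord0 (lshift n i)) p ->
            0 <= (p - u ord0 (lshift n i)) *
                 (f (lshift n i) s - f (lshift n i) (u ord0 (lshift n i))) &
          forall j : 'I_n, forall s : R, s \in segm p (u ord0 (rshift m j)) ->
            0 <= (u ord0 (rshift m j) - p) *
                 (f (rshift m j) s - f (rshift m j) (u ord0 (rshift m j)))]].
Proof.
have left_segm (a b : R) : a \in segm a b by rewrite in_itv /= ge_min le_max lexx.
have right_segm (a b : R) : b \in segm a b.
  by rewrite in_itv /= ge_min le_max lexx !orbT.
apply/seteqP; split=> u [u_r [p p_r [balance in_u out_u]]];
  split=> //; exists p => //; split=> // k;
  by apply/(flux_godunov_eqP _ _ _ _ _ _ (fF _)) => //; auto.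
Qed.
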